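(* Let $M^3$ be a translation hypersurface of type 2 in $\mathbb{I}^4$, i.e. $M^3$ is parameterized by $r(u,v,w)=(u+v,\,w,\,f(u),\,g(v)+h(w))$ with $f,g,h$ smooth real functions of one variable and $f'\neq 0$, and suppose its isotropic mean curvature is a nonzero constant $H_0$. Then, for some $\lambda,\mu,\xi\in\mathbb{R}$, one of the following occurs, up to translations of the parameters and additive constants: (i) $f=f(u)$ with $f'\neq0$ (arbitrary), $g(v)=\lambda$, $h(w)=\frac{3H_0}{2}w^2$; (ii) $f(u)=\lambda u$, $g(v)=\mu v$, $h(w)=\frac{3H_0}{2}w^2$, $\lambda\mu\neq0$; (iii) $f(u)=\lambda u^{\frac12}$, $g(v)=\mu v$, $h(w)=\xi w^2$, $\lambda\mu\neq0$, $\xi\neq\frac{3H_0}{2}$; (iv) $f(u)=\lambda u$, $g(v)=\mu v^2$, $h(w)=\xi w^2$, $\lambda\mu\neq0$, $\xi\neq\frac{3H_0}{2}$; (v) $M^3=S^2\times P$, where $S^2$ is the isotropic Scherk's surface of type 2 in $\mathbb{I}^3$ and $P$ is a parabolic circle in $\mathbb{I}^2$ with isotropic curvature $3H_0$.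
   Context: The isotropic space $\mathbb{I}^n$ is $\mathbb{R}^n$ with affine coordinates $(x_1,\dots,x_n)$ and the degenerate metric $dx_1^2+\dots+dx_{n-1}^2$. Its motions are translations composed with the linear maps given by block matrices $\begin{bmatrix} A & 0 \\ B & 1 \end{bmatrix}$, $A$ orthogonal of size $n-1$ and $B$ a real $1\times(n-1)$ row. All hypersurfaces considered have tangent hyperplanes not parallel to the $x_n$-axis. For a parameterized hypersurface $r$ in $\mathbb{I}^4$, let $[g_{ij}]$ be the matrix of the first fundamental form induced by the degenerate metric and $h_{ij}=\det(r_u,r_v,r_w,r_{ij})/\sqrt{\det g_{ij}}$, with $r_{ij}$ the second partial derivatives. The isotropic mean curvature $H$ is defined by $3H=\mathrm{tr}([h_{ij}][g_{ij}]^{-1})$. For a type 2 hypersurface as in the claim (with the sign convention used here) $$3H=\frac{f''g'}{(f')^3}+g''\,\frac{1+(f')^2}{(f')^2}+h''.$$ The isotropic Scherk's surface of type 2 in $\mathbb{I}^3$ is $x_2=c^{-1}(\ln|c x_3|-\ln|\cos c x_1|)$, $c\in\mathbb{R}$, $c\neq0$. The parabolic circle $P$ of isotropic curvature $3H_0$ is the parabola $x_4=\frac{3H_0}{2}x_2^2$ in the $x_2x_4$-plane (identified with $\mathbb{I}^2$). The equality $M^3=S^2\times P$ means that, up to isotropic motions (in particular translations), $M^3$ is (part of) the hypersurface $$\{p+(0,w,0,\tfrac{3}{2}H_0w^2): p\in S^2,\ w\in\mathbb{R}\},$$ where $S^2$ lies in the hyperplane $x_2=0$ of $\mathbb{I}^4$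 and is given there by $x_1=c^{-1}(\ln|cx_4|-\ln|\cos cx_3|)$ (so $(x_3,x_1,x_4)$ play the role of the coordinates of $\mathbb{I}^3$). ''Up to translations of the parameters and additive constants'' means that each of $f,g,h$ may be replaced by $\varphi(t+t_0)+c$ with $t_0,c\in\mathbb{R}$. In (iii), $u^{1/2}$ is real and understood up to reflection of the argument, i.e. as $(\varepsilon u)^{1/2}$ with $\varepsilon\in\{1,-1\}$.
   Formalization: In (iii) and (iv), when ξ=0, h is allowed to be βw up to translation and an additive constant, since the claim as stated fails for f(u)=u, g(v)=v², h(w)=w, where 3H=4. *)

(* Defs.v *)
From HB Require Import structures.
From mathcomp Require Import all_boot all_order all_algebra.
From mathcomp Require Import all_classical all_reals all_analysis.

Set Implicit Arguments.
Unset Strict Implicit.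
Unset Printing Implicit Defensive.

Import Order.TTheory GRing.Theory Num.Theory.
Import numFieldNormedType.Exports.

Local Open Scope classical_set_scope.
Local Open Scope ring_scope.

(* Coordinates are 0-based: x_1, ..., x_4 are the entries 0, ..., 3
   of a row vector. *)
Definition row4 (R : realType) (a b c d : R) : 'rV[R]_4 :=
  \row_(i < 4) nth 0 [:: a; b; c; d] i.

Definition row3 (R : realType) (a b c : R) : 'rV[R]_3 :=
  \row_(i < 3) nth 0 [:: a; b; c] i.

Definition isotropic_dot (R : realType) (n : nat) (x y : 'rV[R]_n.+1) : R :=
  \sum_(k < n.+1 | k != ord_max) x 0 k * y 0 k.

(* With row vectors, the linear part x |-> M x becomes x |-> x *m M^T. *)
Definition isotropic_motion (R : realType) (n : nat)
    (phi : 'rV[R]_(n + 1) -> 'rV[R]_(n + 1)) : Prop :=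
  exists (A : 'M[R]_n) (B : 'rV[R]_n) (t : 'rV[R]_(n + 1)),
    A *m A^T = 1%:M /\
    forall x, phi x = x *m (block_mx A 0 B 1%:M)^T + t.

Section Hypersurface.
Variables (R : realType) (r : 'rV[R]_3 -> 'rV[R]_4).

Definition partial1 (i : 'I_3) : 'rV[R]_3 -> 'rV[R]_4 :=
  fun p => 'D_(delta_mx 0 i) r p.

Definition partial2 (i j : 'I_3) : 'rV[R]_3 -> 'rV[R]_4 :=
  fun p => 'D_(delta_mx 0 j) (partial1 i) p.

Definition first_form (p : 'rV[R]_3) : 'M[R]_3 :=
  \matrix_(i, j) isotropic_dot (partial1 i p) (partial1 j p).

(* det (r_u, r_v, r_w, x) *)
Definition frame_det (p : 'rV[R]_3) (x : 'rV[R]_4) : R :=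
  \det (col_mx (\matrix_(i < 3) partial1 i p) x : 'M[R]_(3 + 1)).

(* The sign of det (r_u, r_v, r_w, e_4) makes the second form independent of
   the orientation of the parameters: the hypersurface is oriented by e_4.
   For a translation hypersurface of type 2 this determinant is f', and the
   factor is what gives
     3 H = f'' g' / f'^3 + g'' (1 + f'^2) / f'^2 + h''
   also when f' < 0; for f' > 0 the factor is 1. *)
Definition second_form (p : 'rV[R]_3) : 'M[R]_3 :=
  \matrix_(i, j) (Num.sg (frame_det p (delta_mx 0 ord_max))
                  * frame_det p (partial2 i j p)
                  / Num.sqrt (\det (first_form p))).

Definition mean_curvature (p : 'rV[R]_3) : R :=
  \tr (second_form p *m invmx (first_form p)) / 3.

End Hypersurface.

Definition translation_type2 (R : realType) (f g h : R -> R)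
    (p : 'rV[R]_3) : 'rV[R]_4 :=
  let u := p 0 0 in let v := p 0 1 in let w := p 0 2%:R in
  row4 (u + v) w (f u) (g v + h w).

Definition open_interval (R : realType) (I : set R) : Prop :=
  [/\ open I, is_interval I & I !=set0].

Definition smooth_on (R : realType) (I : set R) (f : R -> R) : Prop :=
  forall (n : nat) (x : R), I x -> derivable (derive1n n f) x 1.

(* On I, f is phi up to a translation of the parameter and an additive
   constant; D is the natural domain of phi. *)
Definition eq_up_to_shift (R : realType) (I D : set R) (f phi : R -> R) : Prop :=
  exists t0 c : R, forall t, I t -> D (t + t0) /\ f t = phi (t + t0) + c.

(* h(w) = xi w^2 up to a translation of w and an additive constant.  For xi = 0
   a translation of w cannot absorb a linear term, which therefore has to be
   allowed: f(u) = u, g(v) = v^2, h(w) = w has 3 H = 4, and its linear term is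
   only removed by the isotropic motion x_4 |-> x_4 - x_2. *)
Definition quadratic_profile (R : realType) (K : set R) (xi : R) (h : R -> R) :
    Prop :=
  eq_up_to_shift K setT h (fun w => xi * w ^+ 2) \/
  (xi = 0 /\ exists beta : R, eq_up_to_shift K setT h (fun w => beta * w)).

(* [ln] and division are total, hence the explicit conditions under which both
   logarithms are defined. *)
Definition scherk2 (R : realType) (c : R) : set 'rV[R]_3 :=
  [set x : 'rV[R]_3 |
    [/\ c * x 0 2%:R != 0, cos (c * x 0 0) != 0 &
        x 0 1 = c^-1 * (ln `|c * x 0 2%:R| - ln `|cos (c * x 0 0)|)]].

Definition parabolic_circle (R : realType) (k : R) : set 'rV[R]_2 :=
  [set x : 'rV[R]_2 | x 0 1 = k / 2 * x 0 0 ^+ 2].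

(* I^3 is the hyperplane x_2 = 0 of I^4, its coordinates (x_1, x_2, x_3) being
   (x_3, x_1, x_4) there; I^2 is the x_2x_4-plane. *)
Definition scherk2_times_parabolic (R : realType) (c k : R) : set 'rV[R]_4 :=
  [set row4 (x 0 1) 0 (x 0 0) (x 0 2%:R) + row4 0 (y 0 0) 0 (y 0 1)
    | x in scherk2 c & y in parabolic_circle k].

(* Main.v *)
(* With F = 1 / f', the equation 3 H = 3 H0 separates: h'' is a constant 2 xi
   and, with P = - F F' = f'' / f'^3 and Q = 1 + F^2,
     P(u) g'(v) + Q(u) g''(v) = k,   k = 3 H0 - 2 xi.
   If k = 0, either g' = 0, or g'' = c g' and P = - c Q for some c.  The case
   c = 0 is affine.  For c <> 0, (f - atan F / c)' = 0, so that
   cos (c (f - C)) = (1 + F^2)^(-1/2), where ln (1 + F^2) has derivative 2 c,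
   while c (g - D) = B e^(c v): this is Scherk's surface.
   If k <> 0 and P, Q are not proportional, then g' is constant, hence g'' = 0;
   if they are proportional, then Q is constant, hence P = 0.  When g'' = 0,
   F F' is a nonzero constant m, so F^2 is affine and f' = 1 / F = F' / m. *)

Require Import Defs.
From HB Require Import structures.
From mathcomp Require Import all_boot all_order all_algebra.
From mathcomp Require Import all_classical all_reals all_analysis.
From mathcomp Require Import ring.

Set Implicit Arguments.
Unset Strict Implicit.
Unset Printing Implicit Defensive.

Import Order.TTheory GRing.Theory Num.Theory.
Import numFieldNormedType.Exports.

Local Open Scope classical_set_scope.
Local Open Scope ring_scope.

(** * Sums and determinants of small fixed size *)

Lemma big_ord3 (R : nmodType) (F : 'I_3 -> R) :
  \sum_i F i = F 0 + F 1 + F 2%:R.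
Proof.
rewrite !big_ord_recl big_ord0 addr0 addrA.
by congr (_ + F _ + F _); apply/val_inj.
Qed.

(** Entries are indexed by [nat], so that minors taken through [bump] and tables read by [nth]
    reduce by computation. *)
Definition det3 (R : comNzRingType) (F : nat -> nat -> R) : R :=
    F 0%N 0%N * (F 1%N 1%N * F 2%N 2%N - F 1%N 2%N * F 2%N 1%N)
  - F 0%N 1%N * (F 1%N 0%N * F 2%N 2%N - F 1%N 2%N * F 2%N 0%N)
  + F 0%N 2%N * (F 1%N 0%N * F 2%N 1%N - F 1%N 1%N * F 2%N 0%N).

Lemma det_matrix3 (R : comNzRingType) (F : nat -> nat -> R) :
  \det (\matrix_(i < 3, j < 3) F i j) = det3 F.
Proof.
do 3! rewrite !(expand_det_row _ ord0) /cofactor !big_ord_recl !big_ord0.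
by rewrite !det_mx00 !mxE /= /bump /= /det3; ring.
Qed.

Lemma cofactor_matrix4 (R : comNzRingType) (F : nat -> nat -> R) (i j : 'I_4) :
  cofactor (\matrix_(k < 4, l < 4) F k l) i j =
  (-1) ^+ (i + j) * det3 (fun k l => F (bump i k) (bump j l)).
Proof.
rewrite -det_matrix3 /cofactor.
by congr (_ * \det _); apply/matrixP => k l; rewrite !mxE.
Qed.

(** * Partial derivatives and mean curvature of a translation hypersurface *)

Section partial_derivatives.
Variable R : realType.
Implicit Types (p v : 'rV[R]_3) (F : R -> R).

Lemma row4_derive (a b c d : 'rV[R]_3 -> R) p v (a' b' c' d' : R) :
  is_derive p v a a' -> is_derive p v b b' ->
  is_derive p v c c' -> is_derive p v d d' ->
  is_derive p v (fun q => row4 (a q) (b q) (c q) (d q)) (row4 a' b' c' d').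
Proof.
move=> da db dc dd.
have dr i : is_derive p v (fun q => row4 (a q) (b q) (c q) (d q) 0 i)
    (row4 a' b' c' d' 0 i).
  by rewrite mxE; under eq_fun do rewrite mxE; case: i => -[|[|[|[|]]]].
have dM : derivable (fun q => row4 (a q) (b q) (c q) (d q)) p v.
  by apply/derivable_mxP => i j; rewrite ord1; exact: ex_derive.
apply: DeriveDef => //; rewrite derive_mx //.
by apply/rowP => j; rewrite [LHS]mxE derive_val.
Qed.

(** Along a basis vector the difference quotient is either that of [F] at the coordinate or
    identically zero, so derivability at the single point [p 0 i] suffices. *)
Lemma coord_derive F p (i j : 'I_3) : derivable F (p 0 i) 1 ->
  is_derive p (delta_mx 0 j) (fun q => F (q 0 i))
    ((i == j)%:R * derive1 F (p 0 i)).
Proof.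
move=> dF; have [<-|ij] := eqVneq i j.
  rewrite mul1r derive1E.
  have E : (fun h : R =>
      h^-1 *: (F ((h *: delta_mx 0 i + p) 0 i) - F (p 0 i))) =
      (fun h : R => h^-1 *: (F (h *: 1 + p 0 i) - F (p 0 i))).
    by apply/funext => h; rewrite !mxE !eqxx.
  by apply: DeriveDef; rewrite /derivable /derive /= E.
rewrite mul0r.
have E : (fun h : R => h^-1 *: (F ((h *: delta_mx 0 j + p) 0 i) - F (p 0 i))) =
    cst 0.
  by apply/funext => h; rewrite !mxE (negPf ij) andbF mulr0 add0r subrr scaler0.
apply: DeriveDef; rewrite /derivable /derive /= E.
  exact: is_cvg_cst.
by rewrite lim_cst.
Qed.

Lemma near_coord (P : R -> Prop) p (i : 'I_3) :
  (\forall x \near p 0 i, P x) -> \forall q \near p, P ((q : 'rV[R]_3) 0 i).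
Proof. exact: (@coord_continuous _ _ _ 0 i p). Qed.

Variables f g h : R -> R.

Lemma partial1_translation_type2 i p :
  derivable f (p 0 0) 1 -> derivable g (p 0 1) 1 -> derivable h (p 0 2%:R) 1 ->
  partial1 (translation_type2 f g h) i p =
    row4 ((0 == i)%:R + (1 == i)%:R) (2%:R == i)%:R
      ((0 == i)%:R * derive1 f (p 0 0))
      ((1 == i)%:R * derive1 g (p 0 1) + (2%:R == i)%:R * derive1 h (p 0 2%:R)).
Proof.
move=> df dg dh; rewrite /partial1 /translation_type2.
have dc k : is_derive p (delta_mx 0 i) (fun q : 'rV[R]_3 => q 0 k) (k == i)%:R.
  have := @coord_derive id p k i (@derivable_id _ _ _ _).
  by rewrite derive1_id mulr1.
apply: derive_val; apply: row4_derive.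
- exact: coord_derive i df.
- exact: is_deriveD (coord_derive i dg) (coord_derive i dh).
Qed.

Lemma partial2_translation_type2 i j p :
  (\forall x \near p 0 0, derivable f x 1) ->
  (\forall x \near p 0 1, derivable g x 1) ->
  (\forall x \near p 0 2%:R, derivable h x 1) ->
  derivable (derive1 f) (p 0 0) 1 -> derivable (derive1 g) (p 0 1) 1 ->
  derivable (derive1 h) (p 0 2%:R) 1 ->
  partial2 (translation_type2 f g h) i j p =
    row4 0 0 ((0 == i)%:R * ((0 == j)%:R * derive1 (derive1 f) (p 0 0)))
      ((1 == i)%:R * ((1 == j)%:R * derive1 (derive1 g) (p 0 1)) +
       (2%:R == i)%:R * ((2%:R == j)%:R * derive1 (derive1 h) (p 0 2%:R))).
Proof.
move=> nf ng nh df dg dh; rewrite /partial2.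
(* The closed form of [partial1] is available only where the profiles are derivable, that is near
   [p]; this is enough for differentiating once more. *)
rewrite (@near_eq_derive _ _ _ _ (fun q : 'rV[R]_3 =>
    row4 ((0 == i)%:R + (1 == i)%:R) (2%:R == i)%:R
      ((0 == i)%:R * derive1 f (q 0 0))
      ((1 == i)%:R * derive1 g (q 0 1) +
       (2%:R == i)%:R * derive1 h (q 0 2%:R)))); last first.
  move: (@near_coord (fun x => derivable f x 1) p 0 nf)
    (@near_coord (fun x => derivable g x 1) p 1 ng)
    (@near_coord (fun x => derivable h x 1) p 2%:R nh).
  by apply: filterS3 => q; exact: partial1_translation_type2.
apply: derive_val; apply: row4_derive.
- exact: is_deriveZ (coord_derive j df).
- exact: is_deriveD (is_deriveZ _ (coord_derive j dg))
    (is_deriveZ _ (coord_derive j dh)).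
Qed.

(** With the derivatives at [p] reduced to six numbers only linear algebra remains: the second form
    is diagonal, so the trace involves only the diagonal of the inverse metric. *)
Lemma mean_curvature_frame (r : 'rV[R]_3 -> 'rV[R]_4) p
    (f1 f2 g1 g2 h1 h2 : R) : f1 != 0 ->
  (forall i, partial1 r i p =
    row4 ((0 == i)%:R + (1 == i)%:R) (2%:R == i)%:R ((0 == i)%:R * f1)
      ((1 == i)%:R * g1 + (2%:R == i)%:R * h1)) ->
  (forall i j, partial2 r i j p =
    row4 0 0 ((0 == i)%:R * ((0 == j)%:R * f2))
      ((1 == i)%:R * ((1 == j)%:R * g2) +
       (2%:R == i)%:R * ((2%:R == j)%:R * h2))) ->
  3 * mean_curvature r p =
    f2 * g1 / f1 ^+ 3 + g2 * ((1 + f1 ^+ 2) / f1 ^+ 2) + h2.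
Proof.
move=> f0 P1 P2.
pose G (i j : nat) : R := nth 0 (nth [::] [:: [:: 1 + f1 ^+ 2; 1; 0];
  [:: 1; 1; 0]; [:: 0; 0; 1]] i) j.
pose G' (i j : nat) : R := nth 0 (nth [::] [:: [:: f1 ^- 2; - f1 ^- 2; 0];
  [:: - f1 ^- 2; (1 + f1 ^+ 2) / f1 ^+ 2; 0]; [:: 0; 0; 1]] i) j.
have GE : first_form r p = \matrix_(i < 3, j < 3) G i j.
  apply/matrixP => i j; rewrite !mxE /isotropic_dot !P1.
  rewrite big_mkcond !big_ord_recl big_ord0 /= !mxE /=.
  by case: i j => -[|[|[|]]] // ? [] [|[|[|]]] // ?; rewrite /G /=; ring.
have detG : \det (first_form r p) = f1 ^+ 2.
  by rewrite GE det_matrix3 /det3 /G /=; ring.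
have invG : invmx (first_form r p) = \matrix_(i < 3, j < 3) G' i j.
  have GG' : first_form r p *m (\matrix_(i < 3, j < 3) G' i j) = 1%:M.
    rewrite GE; apply/matrixP => i j; rewrite !mxE big_ord3 !mxE /G /G'.
    by case: i j => -[|[|[|]]] // ? [] [|[|[|]]] // ? /=; field.
  have GU : first_form r p \in unitmx by case: (mulmx1_unit GG').
  by rewrite -[RHS](mulKmx GU) GG' mulmx1.
(* The determinant as a linear form in its last row; the coefficients are the cofactors of that
   row. *)
have FE (x : 'rV[R]_4) : frame_det r p x =
    x 0 3%:R * f1 + x 0 2%:R * g1 + x 0 1 * (- f1 * h1) - x 0 0 * f1 * g1.
  rewrite /frame_det.
  pose M (i j : nat) : R := nth 0 (nth [::] [:: [:: 1; 0; f1; 0];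
    [:: 1; 0; 0; g1]; [:: 0; 1; 0; h1];
    [:: x 0 0; x 0 1; x 0 2%:R; x 0 3%:R]] i) j.
  have -> : col_mx (\matrix_(i < 3) partial1 r i p) x =
      \matrix_(i < 3 + 1, j < 3 + 1) M i j.
    apply/matrixP => i j; rewrite mxE; case: splitP => k ik.
      rewrite mxE P1 mxE mxE ik /M.
      by case: k j {ik} => -[|[|[|]]] // ? [] [|[|[|[|]]]] // ? /=; ring.
    rewrite !mxE ik ord1 /M.
    by case: j => -[|[|[|[|]]]] // ? /=; congr (x _ _); apply/val_inj.
  rewrite (expand_det_row _ ord_max) !big_ord_recl big_ord0 !cofactor_matrix4.
  by rewrite !mxE /det3 /bump /M /=; ring.
have sqrtG : Num.sqrt (\det (first_form r p)) = `|f1|.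
  by rewrite detG sqrtr_sqr.
have e4 : frame_det r p (delta_mx 0 ord_max) = f1.
  by rewrite FE !mxE /=; ring.
have SE : second_form r p = \matrix_(i < 3, j < 3)
    ((i == j)%:R * nth 0 [:: f2 * g1 / f1; g2; h2] i).
  apply/matrixP => i j; rewrite !mxE sqrtG e4.
  have -> : frame_det r p (partial2 r i j p) =
      f1 * ((i == j)%:R * nth 0 [:: f2 * g1 / f1; g2; h2] i).
    rewrite FE P2 !mxE /=.
    by case: i j => -[|[|[|]]] // ? [] [|[|[|]]] // ? /=; field.
  (* The determinants carry a factor [f1], which the orientation sign turns into [|f1|]; this
     cancels the square root of the metric determinant. *)
  have sgf1 : Num.sg f1 * f1 = `|f1| by rewrite normrEsg.
  by rewrite [Num.sg f1 * _]mulrA sgf1 mulrC mulKf // normr_eq0.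
rewrite /mean_curvature mulrC divfK ?pnatr_eq0 // invG SE /mxtrace.
rewrite big_ord3 !mxE !big_ord3 !mxE /G' /=.
by field.
Qed.

Lemma mean_curvature_translation_type2 (u v w : R) :
  (\forall x \near u, derivable f x 1) ->
  (\forall x \near v, derivable g x 1) ->
  (\forall x \near w, derivable h x 1) ->
  derivable (derive1 f) u 1 -> derivable (derive1 g) v 1 ->
  derivable (derive1 h) w 1 -> derive1 f u != 0 ->
  3 * mean_curvature (translation_type2 f g h) (row3 u v w) =
    derive1 (derive1 f) u * derive1 g v / derive1 f u ^+ 3
    + derive1 (derive1 g) v * ((1 + derive1 f u ^+ 2) / derive1 f u ^+ 2)
    + derive1 (derive1 h) w.
Proof.
move=> nf ng nh df dg dh f0.
set p := row3 u v w.
have [p0 p1 p2] : [/\ p 0 0 = u, p 0 1 = v & p 0 2%:R = w] by rewrite !mxE.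
apply: (@mean_curvature_frame _ _ _ _ _ _ (derive1 h w)) => // [i|i j].
  rewrite -{1}p0 -{1}p1 -{1}p2; apply: partial1_translation_type2.
  - by rewrite p0; exact: (nbhs_singleton nf).
  - by rewrite p1; exact: (nbhs_singleton ng).
  - by rewrite p2; exact: (nbhs_singleton nh).
rewrite -p0 -p1 -p2; apply: partial2_translation_type2;
  by rewrite ?(p0, p1, p2).
Qed.

End partial_derivatives.

(** * Functions on an interval with prescribed derivatives *)

Section real_functions.
Variable R : realType.
Implicit Types (I J : set R) (f g : R -> R).

Lemma derive0_eq I f : is_interval I ->
  (forall x, I x -> is_derive x 1 f 0) ->
  forall x y, I x -> I y -> f x = f y.
Proof.
move=> iI df x y; wlog xy : x y / x <= y.
  by move=> H Ix Iy; case: (leP x y) => [|/ltW] xy; [exact: H|apply/esym/H].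
move=> Ix Iy.
have Ixy z : z \in `[x, y] -> I z by rewrite in_itv; exact: iI.
have [| |z _] := @MVT_segment R f (cst 0) x y xy.
- by move=> z zxy; apply: df; apply: Ixy; exact: subset_itv_oo_cc.
- apply: derivable_within_continuous => z /Ixy /df dfz.
  exact: ex_derive.
by rewrite mul0r => /eqP; rewrite subr_eq0 => /eqP.
Qed.

Lemma cst_derive0 I f c x d : open I -> (forall y, I y -> f y = c) -> I x ->
  is_derive x 1 f d -> d = 0.
Proof.
move=> oI fc Ix df.
have : is_derive x 1 (cst c : R -> R) d.
  apply: near_eq_is_derive df.
  by move: (open_nbhs_nbhs (conj oI Ix)); apply: filterS => y /fc ->.
by move=> [_ <-]; rewrite derive_cst.
Qed.

Lemma derive_cst_affine I f c : is_interval I -> I !=set0 ->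
  (forall x, I x -> is_derive x 1 f c) ->
  exists d, forall x, I x -> f x = c * x + d.
Proof.
move=> iI [x0 Ix0] df; exists (f x0 - c * x0) => x Ix.
have dg y : I y -> is_derive y 1 (fun z => f z - c * z) 0.
  move=> /df dfy; apply: is_derive_eq.
  by rewrite /GRing.scale /= mulr1 subrr.
by have /= <- := derive0_eq iI dg Ix Ix0; rewrite addrC subrK.
Qed.

Lemma derive2_cst_quadratic I f f1 c : is_interval I -> I !=set0 ->
  (forall x, I x -> is_derive x 1 f (f1 x)) ->
  (forall x, I x -> is_derive x 1 f1 (2 * c)) ->
  exists b d, forall x, I x -> f x = c * x ^+ 2 + b * x + d.
Proof.
move=> iI I0 df df1; have [b f1E] := derive_cst_affine iI I0 df1.
have dg x : I x -> is_derive x 1 (fun y => f y - c * y ^+ 2) b.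
  move=> Ix; have := df x Ix; rewrite (f1E _ Ix) => dfx.
  apply: is_derive_eq.
  by rewrite /GRing.scale /=; ring.
have [d fE] := derive_cst_affine iI I0 dg.
by exists b, d => x Ix; rewrite -addrA -fE // addrC subrK.
Qed.

(** A change of sign would produce a zero by the intermediate value theorem. The factor [s] is meant
    to be absorbed into a multiplicative constant. *)
Lemma constant_sign I f : is_interval I -> I !=set0 ->
  (forall x, I x -> derivable f x 1) -> (forall x, I x -> f x != 0) ->
  exists2 s, s != 0 & forall x, I x -> f x = s * `|f x|.
Proof.
move=> iI [x0 Ix0] df f0.
exists (Num.sg (f x0)); first by rewrite sgr_eq0 f0.
suff sgE x y : I x -> I y -> x <= y -> Num.sg (f x) = Num.sg (f y).
  move=> x Ix; suff -> : Num.sg (f x0) = Num.sg (f x) by rewrite -numEsg.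
  by case: (leP x x0) => [|/ltW] xx0; [apply/esym|]; exact: sgE.
move=> Ix Iy xy.
have Ixy z : z \in `[x, y] -> I z by rewrite in_itv; exact: iI.
have cf : {within `[x, y], continuous f}.
  by apply: derivable_within_continuous => z /Ixy; exact: df.
apply/eqP; apply: contraT => sgxy.
have [|z zxy fz] := IVT (v := 0) xy cf.
  move: sgxy (f0 _ Ix) (f0 _ Iy); rewrite ge_min le_max.
  by case: (sgrP (f x)) => fx; case: (sgrP (f y)) => fy;
    rewrite ?eqxx ?(ltW fx) ?(ltW fy) ?orbT.
by have := f0 _ (Ixy _ zxy); rewrite fz eqxx.
Qed.

Lemma eq_up_to_shift_affine I f l d : (forall x, I x -> f x = l * x + d) ->
  eq_up_to_shift I setT f (fun u => l * u).
Proof. by move=> fE; exists 0, d => t It; rewrite addr0 fE. Qed.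

(** Completing the square: the shift [b / (2 * c)] absorbs the linear term, which requires
    [c != 0]. *)
Lemma eq_up_to_shift_quadratic I f c b d : c != 0 ->
  (forall x, I x -> f x = c * x ^+ 2 + b * x + d) ->
  eq_up_to_shift I setT f (fun u => c * u ^+ 2).
Proof.
move=> c0 fE; exists (b / (2 * c)), (d - b ^+ 2 / (4 * c)) => t It.
by rewrite fE //; split => //; field.
Qed.

End real_functions.

(** * The separated equation in [u] and [v] *)

Section separated_equation.
Variables (R : realType) (I J : set R) (P Q g1 g2 : R -> R) (k : R).
Hypotheses (oI : open I) (I0 : I !=set0) (oJ : open J).
Hypothesis dQ : forall u, I u -> is_derive u 1 Q (- 2 * P u).
Hypothesis dg1 : forall v, J v -> is_derive v 1 g1 (g2 v).
Hypothesis Q0 : forall u, I u -> Q u != 0.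
Hypothesis PQ : forall u v, I u -> J v -> P u * g1 v + Q u * g2 v = k.

(** At a point [v0] with [g1 v0 != 0] the equation makes [P] a multiple of [Q]; substituting this
    back and dividing by [Q] gives the linear equation for [g1]. *)
Lemma separated_equation0 : k = 0 ->
  (forall v, J v -> g1 v = 0) \/
  exists c, [/\ exists2 v, J v & g1 v != 0,
    forall v, J v -> g2 v = c * g1 v & forall u, I u -> P u = - c * Q u].
Proof.
move=> k0; have [g10|/existsNP[v0 /not_implyP[Jv0 /eqP g1v0]]] :=
  pselect (forall v, J v -> g1 v = 0); first by left.
right; exists (g2 v0 / g1 v0).
have PE u : I u -> P u = - (g2 v0 / g1 v0) * Q u.
  move=> Iu; apply: (mulIf g1v0); rewrite mulrAC mulNr divfK // mulNr.
  apply/eqP; rewrite -addr_eq0 mulrC.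
  by rewrite [g2 _ * _]mulrC [g1 _ * _]mulrC PQ // k0.
split=> //; first by exists v0.
move=> v Jv; have [u0 Iu0] := I0; apply: (mulfI (Q0 Iu0)).
have := PQ Iu0 Jv; rewrite k0 PE // => /eqP.
rewrite addrC addr_eq0 => /eqP ->.
by ring.
Qed.

Lemma separated_equation_neq0 : k != 0 ->
  (forall v, J v -> g2 v = 0) \/ (forall u, I u -> P u = 0).
Proof.
move=> k0; have [g20|/existsNP[v0 /not_implyP[Jv0 /eqP g2v0]]] :=
  pselect (forall v, J v -> g2 v = 0); first by left.
right; have [u0 Iu0] := I0.
(* Otherwise Cramer's rule for the equations at [u] and [u0] gives [g1 v] a value independent of
   [v], so that [g2] vanishes, against the choice of [v0]. *)
have prop u : I u -> P u * Q u0 = P u0 * Q u.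
  move=> Iu; apply/eqP/negP => /negP; rewrite -subr_eq0 => D0.
  have g1E v : J v -> g1 v = k * (Q u0 - Q u) / (P u * Q u0 - P u0 * Q u).
    move=> Jv; apply: (mulIf D0); rewrite divfK //.
    by rewrite [RHS]mulrBr -{1}(PQ Iu Jv) -(PQ Iu0 Jv); ring.
  by move/eqP: g2v0; apply; exact: cst_derive0 oJ g1E Jv0 (dg1 Jv0).
(* Since [P] is proportional to [Q], the equation at [v0] reads [Q u] times a constant equals [k];
   as [k != 0] that constant can be inverted, and [Q] is constant. *)
have QE u : I u -> Q u = k / (P u0 / Q u0 * g1 v0 + g2 v0).
  move=> Iu.
  have E : Q u * (P u0 / Q u0 * g1 v0 + g2 v0) = k.
    have Pu : P u = P u0 / Q u0 * Q u by rewrite mulrAC -prop // mulfK ?Q0.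
    by rewrite -(PQ Iu Jv0) Pu; ring.
  have X0 : P u0 / Q u0 * g1 v0 + g2 v0 != 0.
    by apply: contraNneq k0 => X0; rewrite -E X0 mulr0.
  by rewrite -E mulfK.
move=> u Iu; have := cst_derive0 oI QE Iu (dQ Iu).
by move/eqP; rewrite mulf_eq0 oppr_eq0 pnatr_eq0 /= => /eqP.
Qed.

End separated_equation.

(** * Explicit integration of the profile functions *)

Section profiles.
Variable R : realType.
Implicit Types (I J K : set R) (f g h F : R -> R).

(** [F ^+ 2] has derivative [2 * m], hence is affine, and [f - F / m] is constant. The constant sign
    of [F] enters [lambda], while the sign of [m] is [eps]. *)
Lemma sqrt_profile I f F F' m : is_interval I -> I !=set0 -> m != 0 ->
  (forall u, I u -> F u != 0) ->
  (forall u, I u -> is_derive u 1 f (F u)^-1) ->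
  (forall u, I u -> is_derive u 1 F (F' u)) ->
  (forall u, I u -> F u * F' u = m) ->
  exists2 lambda, lambda != 0 & exists eps : R, (eps = 1 \/ eps = -1) /\
    eq_up_to_shift I [set u | 0 < eps * u] f
      (fun u => lambda * Num.sqrt (eps * u)).
Proof.
move=> iI I0 m0 F0 df dF FF'.
have dF2 u : I u -> is_derive u 1 (fun x => F x ^+ 2) (2 * m).
  move=> Iu; have := dF u Iu => dFu; apply: is_derive_eq.
  by rewrite /GRing.scale /= -(FF' _ Iu); ring.
have [d F2E] := derive_cst_affine iI I0 dF2.
have dfF u : I u -> is_derive u 1 (fun x => f x - F x / m) 0.
  move=> Iu; have := dF u Iu => dFu; have := df u Iu => dfu.
  apply: is_derive_eq; rewrite /GRing.scale /= -(FF' _ Iu).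
  have F'0 : F' u != 0.
    by apply: contraNneq m0 => F'0; rewrite -(FF' _ Iu) F'0 mulr0.
  by have := F0 _ Iu => Fu0; field; apply/andP.
have [C fE] := derive_cst_affine iI I0 dfF.
have [s s0 Fs] : exists2 s, s != 0 & forall x, I x -> F x = s * `|F x|.
  by apply: constant_sign => // x /dF dFx; exact: ex_derive.
pose a := `|2 * m|.
have a0 : 0 < a by rewrite normr_gt0 mulf_neq0 ?pnatr_eq0.
(* From [f = F / m + C] and [F = s * |F|], where [|F|] is [Num.sqrt a] times the square root of the
   shifted and reflected parameter. *)
exists (s * Num.sqrt a / m).
  by rewrite !mulf_neq0 ?invr_eq0 // gt_eqF // sqrtr_gt0.
exists (Num.sg m); split.
  case: (ltgtP m 0) m0 => // ms _.
    by right; rewrite ltr0_sg.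
  by left; rewrite gtr0_sg.
(* The shift moves the zero of [2 * m * t + d], the affine form of [F ^+ 2], to the origin. *)
exists (d / (2 * m)), C => t It /=.
have E : a * (Num.sg m * (t + d / (2 * m))) = F t ^+ 2.
  rewrite F2E // /a normrM (ger0_norm (ler0n _ _)) mulrA -(mulrA 2 `|m|).
  rewrite [`|m| * _]mulrC -numEsg mulrDr mulrCA divff ?mulr1 //.
  by rewrite mulf_neq0 ?pnatr_eq0.
have pos : 0 < Num.sg m * (t + d / (2 * m)).
  by rewrite -(pmulr_rgt0 _ a0) E exprn_even_gt0 //= F0.
split => //; have /eqP := fE _ It; rewrite mul0r add0r subr_eq => /eqP ->.
rewrite addrC; congr (_ + _).
by rewrite [RHS]mulrAC -(mulrA s) -sqrtrM ?(ltW a0) // E sqrtr_sqr -Fs.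
Qed.

(** The integrating factor [expR (- c * x)] makes [g1] an exponential with coefficient [B], and
    [g - g1 / c] is a constant [D]; [B] is nonzero because [g1] is nonzero somewhere. *)
Lemma exponential_profile J g g1 c : is_interval J -> c != 0 ->
  (exists2 v, J v & g1 v != 0) ->
  (forall v, J v -> is_derive v 1 g (g1 v)) ->
  (forall v, J v -> is_derive v 1 g1 (c * g1 v)) ->
  exists B D, B != 0 /\
    forall v, J v -> c * (g v - D) = B * expR (c * v).
Proof.
move=> iJ c0 [v0 Jv0 g1v0] dg dg1.
have J0 : J !=set0 by exists v0.
have dE v : J v -> is_derive v 1 (fun x => g1 x * expR (- c * x)) 0.
  move=> Jv; have := dg1 v Jv => dg1v; apply: is_derive_eq.
  by rewrite /GRing.scale /=; ring.
have [B BE] := derive_cst_affine iJ J0 dE.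
have dD v : J v -> is_derive v 1 (fun x => g x - g1 x / c) 0.
  move=> Jv; have := dg1 v Jv => dg1v; have := dg v Jv => dgv.
  by apply: is_derive_eq; rewrite /GRing.scale /=; field.
have [D DE] := derive_cst_affine iJ J0 dD.
exists B, D; split.
  have := BE _ Jv0; rewrite mul0r add0r => <-.
  by rewrite mulf_neq0 // gt_eqF // expR_gt0.
move=> v Jv; have := DE _ Jv; rewrite mul0r add0r => <-.
have := BE _ Jv; rewrite mul0r add0r => <-.
rewrite -mulrA -expRD -mulrDl addNr mul0r expR0 mulr1.
by field.
Qed.

(** Since [c * (f - C) = atan F], the cosine is the inverse square root of [1 + F ^+ 2]: it is
    positive, and minus its logarithm is half of the affine function [ln (1 + F ^+ 2)]. *)
Lemma scherk_profile I f F F' c : is_interval I -> I !=set0 -> c != 0 ->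
  (forall u, I u -> F u != 0) ->
  (forall u, I u -> is_derive u 1 f (F u)^-1) ->
  (forall u, I u -> is_derive u 1 F (F' u)) ->
  (forall u, I u -> F u * F' u = c * (1 + F u ^+ 2)) ->
  exists A C, forall u, I u ->
    cos (c * (f u - C)) != 0 /\ - ln `|cos (c * (f u - C))| = A + c * u.
Proof.
move=> iI I0 c0 F0 df dF FF'.
have F2 u : 0 < 1 + F u ^+ 2 by rewrite ltr_pwDl // sqr_ge0.
have dln u : I u -> is_derive u 1 (fun x => ln (1 + F x ^+ 2)) (2 * c).
  move=> Iu; have := dF u Iu => dFu.
  have dlnu := is_derive1_ln (F2 u).
  have d1 : is_derive u 1 (fun x => 1 + F x ^+ 2) (2 * c * (1 + F u ^+ 2)).
    apply: is_derive_eq; rewrite /GRing.scale /= -[RHS]mulrA -FF' //.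
    by ring.
  apply: is_derive_eq; rewrite mulrC mulfK // gt_eqF //.
have [A AE] := derive_cst_affine iI I0 dln.
have datan u : I u -> is_derive u 1 (fun x => f x - atan (F x) / c) 0.
  move=> Iu; have := dF u Iu => dFu; have := df u Iu => dfu.
  apply: is_derive_eq; rewrite /GRing.scale /=.
  have -> : F' u = c * (1 + F u ^+ 2) / F u by rewrite -FF' // mulrC mulKf ?F0.
  by field; rewrite c0 F0 // gt_eqF.
have [C CE] := derive_cst_affine iI I0 datan.
exists (A / 2), C => u Iu.
have fE : c * (f u - C) = atan (F u).
  by have := CE _ Iu; rewrite mul0r add0r => <-; field.
rewrite fE cos_atan; have s0 : 0 < Num.sqrt (1 + F u ^+ 2) by rewrite sqrtr_gt0.
split; first by rewrite invr_eq0 gt_eqF.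
rewrite gtr0_norm ?invr_gt0 // lnV // opprK.
have -> : A / 2 + c * u = 2^-1 * (2 * c * u + A) by field.
rewrite -AE // -[in RHS](sqr_sqrtr (ltW (F2 u))) lnXn //.
by field.
Qed.

End profiles.

(** * Translations and points of the product of Scherk's surface with a parabola *)

Lemma translation_isotropic_motion (R : realType) n (t : 'rV[R]_(n + 1)) :
  isotropic_motion (fun x => x + t).
Proof.
exists 1%:M, 0, t; split=> [|x]; first by rewrite trmx1 mulmx1.
by rewrite -scalar_mx_block trmx1 mulmx1.
Qed.

Lemma scherk2_times_parabolicP (R : realType) (c k x1 x2 x3 x4 : R) :
  c * x4 != 0 -> cos (c * x3) != 0 ->
  x1 = c^-1 * (ln `|c * x4| - ln `|cos (c * x3)|) ->
  scherk2_times_parabolic c k (row4 x1 x2 x3 (x4 + k / 2 * x2 ^+ 2)).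
Proof.
(* The Scherk factor reads the coordinates in the order [x3], [x1], [x4]. *)
move=> x40 cosx3 x1E; exists (row3 x3 x1 x4); first by split; rewrite !mxE.
exists (\row_(i < 2) nth 0 [:: x2; k / 2 * x2 ^+ 2] i).
  by rewrite /parabolic_circle /= !mxE.
apply/rowP => i; rewrite !mxE /=.
by case: i => -[|[|[|[|]]]] // ? /=; rewrite ?(addr0, add0r).
Qed.

(** * From smooth profiles to a pointwise differential equation *)

Section smooth.
Variables (R : realType) (I : set R) (f : R -> R).
Hypothesis sf : smooth_on I f.

Lemma smooth_on_is_derive x : I x -> is_derive x 1 f (derive1 f x).
Proof. by move=> /(@sf 0%N) /derivableP; rewrite derive1E. Qed.

Lemma smooth_on_derive1 : smooth_on I (derive1 f).
Proof. by move=> n x /(@sf n.+1); rewrite derive1Sn. Qed.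

Lemma smooth_on_near x : open I -> I x -> \forall y \near x, derivable f y 1.
Proof.
move=> oI Ix; move: (open_nbhs_nbhs (conj oI Ix)).
by apply: filterS => y /(@sf 0%N).
Qed.

End smooth.

(** Extracts all that the classification uses of smoothness and curvature: two derivatives of each
    profile and one pointwise equation between them. *)
Lemma mean_curvature_equation (R : realType) (I J K : set R) (f g h : R -> R)
    (H0 : R) : open I -> open J -> open K ->
  smooth_on I f -> smooth_on J g -> smooth_on K h ->
  (forall u, I u -> derive1 f u != 0) ->
  (forall u v w, I u -> J v -> K w ->
     mean_curvature (translation_type2 f g h) (row3 u v w) = H0) ->
  exists f1 f2 g1 g2 h1 h2 : R -> R, [/\
    (forall u, I u -> is_derive u 1 f (f1 u)) /\
    (forall u, I u -> is_derive u 1 f1 (f2 u)),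
    (forall v, J v -> is_derive v 1 g (g1 v)) /\
    (forall v, J v -> is_derive v 1 g1 (g2 v)),
    (forall w, K w -> is_derive w 1 h (h1 w)) /\
    (forall w, K w -> is_derive w 1 h1 (h2 w)),
    forall u, I u -> f1 u != 0 &
    forall u v w, I u -> J v -> K w ->
      f2 u * g1 v / f1 u ^+ 3 + g2 v * ((1 + f1 u ^+ 2) / f1 u ^+ 2) + h2 w =
      3 * H0].
Proof.
move=> oI oJ oK hf hg hh hf' hH.
exists (derive1 f), (derive1 (derive1 f)), (derive1 g), (derive1 (derive1 g)),
  (derive1 h), (derive1 (derive1 h)).
split=> [||||u v w].
- split=> x Ix; first exact (smooth_on_is_derive hf Ix).
  exact (smooth_on_is_derive (smooth_on_derive1 hf) Ix).
- split=> x Ix; first exact (smooth_on_is_derive hg Ix).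
  exact (smooth_on_is_derive (smooth_on_derive1 hg) Ix).
- split=> x Ix; first exact (smooth_on_is_derive hh Ix).
  exact (smooth_on_is_derive (smooth_on_derive1 hh) Ix).
- exact: hf'.
- move=> Iu Jv Kw; rewrite -(hH u v w Iu Jv Kw).
  rewrite mean_curvature_translation_type2 ?hf' //.
  * exact (smooth_on_near hf oI Iu).
  * exact (smooth_on_near hg oJ Jv).
  * exact (smooth_on_near hh oK Kw).
  * exact: @smooth_on_derive1 _ _ _ hf 0%N _ Iu.
  * exact: @smooth_on_derive1 _ _ _ hg 0%N _ Jv.
  * exact: @smooth_on_derive1 _ _ _ hh 0%N _ Kw.
Qed.

(** * Classification by cases on the separation constant *)

Theorem theorem4p3 (R : realType) (I J K : set R) (f g h : R -> R) (H0 : R)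
    (hI : open_interval I) (hJ : open_interval J) (hK : open_interval K)
    (hf : smooth_on I f) (hg : smooth_on J g) (hh : smooth_on K h)
    (hf' : forall u, I u -> derive1 f u != 0)
    (hH0 : H0 != 0)
    (hH : forall u v w, I u -> J v -> K w ->
       mean_curvature (translation_type2 f g h) (row3 u v w) = H0) :
  exists lambda mu xi : R,
    (* (i) *)
    (eq_up_to_shift J setT g (fun=> lambda) /\
     eq_up_to_shift K setT h (fun w => 3 * H0 / 2 * w ^+ 2)) \/
    (* (ii) *)
    [/\ lambda * mu != 0,
        eq_up_to_shift I setT f (fun u => lambda * u),
        eq_up_to_shift J setT g (fun v => mu * v) &
        eq_up_to_shift K setT h (fun w => 3 * H0 / 2 * w ^+ 2)] \/
    (* (iii) *)
    [/\ lambda * mu != 0,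
        xi != 3 * H0 / 2,
        exists eps : R, (eps = 1 \/ eps = -1) /\
          eq_up_to_shift I [set u | 0 < eps * u] f
            (fun u => lambda * Num.sqrt (eps * u)),
        eq_up_to_shift J setT g (fun v => mu * v) &
        quadratic_profile K xi h] \/
    (* (iv) *)
    [/\ lambda * mu != 0,
        xi != 3 * H0 / 2,
        eq_up_to_shift I setT f (fun u => lambda * u),
        eq_up_to_shift J setT g (fun v => mu * v ^+ 2) &
        quadratic_profile K xi h] \/
    (* (v) *)
    exists (c : R) (phi : 'rV[R]_(3 + 1) -> 'rV[R]_(3 + 1)),
      [/\ c != 0, isotropic_motion phi &
          forall u v w, I u -> J v -> K w ->
            scherk2_times_parabolic c (3 * H0)
              (phi (translation_type2 f g h (row3 u v w)))].
Proof.
have [[oI iI I0] [oJ iJ J0] [oK iK K0]] := And3 hI hJ hK.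
have [[u0 Iu0] [v0 Jv0] [w0 Kw0]] := And3 I0 J0 K0.
have [f1 [f2 [g1 [g2 [h1 [h2 [[df df1] [dg dg1] [dh dh1] f10 mean]]]]]]] :=
  mean_curvature_equation oI oJ oK hf hg hh hf' hH.
(* Comparing the curvature equation at [w] and [w0], with [u0] and [v0] fixed, shows that [h2] is
   constant; half its value is the leading coefficient of [h]. *)
pose xi := h2 w0 / 2.
have xi2 : 2 * xi = h2 w0 by rewrite /xi; field.
have [b [d hE]] : exists b d, forall w, K w -> h w = xi * w ^+ 2 + b * w + d.
  apply: derive2_cst_quadratic dh _ => // w Kw.
  have -> : 2 * xi = h2 w; last exact: dh1.
  by rewrite xi2; have /addrI := etrans (mean _ _ _ Iu0 Jv0 Kw0)
    (esym (mean _ _ _ Iu0 Jv0 Kw)).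
pose F u := (f1 u)^-1.
pose F' u := - f2 u / f1 u ^+ 2.
have F0 u : I u -> F u != 0 by move=> Iu; rewrite invr_eq0 f10.
have dfF u : I u -> is_derive u 1 f (F u)^-1.
  by move=> Iu; rewrite /F invrK; exact: df.
have dF u : I u -> is_derive u 1 F (F' u).
  move=> Iu; have := df1 u Iu => df1u; have := f10 u Iu => f'u.
  apply: is_derive_eq (is_deriveV f'u df1u) _.
  by rewrite /F' /GRing.scale /=; field.
pose P u := - (F u * F' u).
pose Q u := 1 + F u ^+ 2.
have Q0 u : I u -> Q u != 0.
  by move=> _; rewrite gt_eqF // ltr_pwDl // sqr_ge0.
have dQ u : I u -> is_derive u 1 Q (- 2 * P u).
  move=> Iu; have := dF u Iu => dFu.
  by apply: is_derive_eq; rewrite /P /GRing.scale /=; ring.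
have PQ u v : I u -> J v ->
    P u * g1 v + Q u * g2 v = 3 * H0 - 2 * xi.
  move=> Iu Jv; rewrite -(mean u v w0 Iu Jv Kw0) /P /Q /F /F' /xi.
  by have := f10 u Iu => f'u; field.
have FP u m : P u = - m -> F u * F' u = m by move/oppr_inj.
(* Common to cases (ii) and (iv): as [F] has no zero, the second derivative of [f] vanishes. *)
have f_affine : (forall u, I u -> F u * F' u = 0) ->
    eq_up_to_shift I setT f (fun u => f1 u0 * u).
  move=> FF'0.
  have f2E u : I u -> is_derive u 1 f1 0.
    move=> Iu; have /eqP := FF'0 u Iu; rewrite mulf_eq0 (negPf (F0 u Iu)) /=.
    rewrite mulf_eq0 oppr_eq0 invr_eq0 expf_eq0 (negPf (f10 u Iu)) andbF orbF.
    by move=> /eqP f2u; rewrite -[X in is_derive _ _ _ X]f2u; exact: df1.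
  have [|l fE] := @derive_cst_affine _ _ f (f1 u0) iI I0.
    by move=> u Iu; rewrite -(derive0_eq iI f2E Iu Iu0); exact: df.
  exact: eq_up_to_shift_affine fE.
(* Common to cases (ii) and (iii). *)
have g_affine : (forall v, J v -> g2 v = 0) ->
    (forall v, J v -> g1 v = g1 v0) /\
    eq_up_to_shift J setT g (fun v => g1 v0 * v).
  move=> g20.
  have g1E v : J v -> g1 v = g1 v0.
    move=> Jv; apply: derive0_eq iJ _ _ _ Jv Jv0 => x Jx.
    by rewrite -(g20 x Jx); exact: dg1.
  split=> //; have [|l gE] := @derive_cst_affine _ _ g (g1 v0) iJ J0.
    by move=> v Jv; rewrite -(g1E v Jv); exact: dg.
  exact: eq_up_to_shift_affine gE.
have [k0|k0] := eqVneq (3 * H0 - 2 * xi) 0.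
  have xiE : xi = 3 * H0 / 2.
    by move/eqP: k0; rewrite subr_eq0 => /eqP ->; field.
  (* This is where [H0 != 0] enters: the linear term of [h] can be absorbed by a shift. *)
  have xi0 : xi != 0 by rewrite xiE !mulf_neq0 ?invr_eq0 ?pnatr_eq0.
  have hS := eq_up_to_shift_quadratic xi0 hE; rewrite xiE in hS.
  have [g10|[c [g1_neq0 g2E PE]]] := separated_equation0 I0 Q0 PQ k0.
    have [l gE] : exists l, forall v, J v -> g v = 0 * v + l.
      by apply: derive_cst_affine => // v Jv; rewrite -(g10 v Jv); exact: dg.
    (* Case (i): only [lambda] occurs, so the other two parameters are arbitrary. *)
    exists l, 0, 0; left; split => //.
    by exists 0, 0 => v Jv; rewrite gE // mul0r add0r !addr0.
  have {}PE u : I u -> F u * F' u = c * Q u.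
    by move=> Iu; apply: FP; rewrite PE // mulNr.
  have [c0|c0] := eqVneq c 0.
    have [|g1E gE] := g_affine.
      by move=> v Jv; rewrite g2E // c0 mul0r.
    exists (f1 u0), (g1 v0), 0; right; left; split => //.
      have [v Jv] := g1_neq0; rewrite g1E // => g1v0.
      by rewrite mulf_neq0 ?f10.
    by apply: f_affine => u Iu; rewrite PE // c0 mul0r.
  have [B [D [B0 gE]]] : exists B D, B != 0 /\
      forall v, J v -> c * (g v - D) = B * expR (c * v).
    apply: exponential_profile g1_neq0 dg _ => // v Jv.
    by rewrite -g2E //; exact: dg1.
  have [A [C fE]] := scherk_profile iI I0 c0 F0 dfF dF PE.
  exists 0, 0, 0; do 4!right.
  (* Completing the square gives [h w = xi * (w + s) ^+ 2 + e]. *)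
  pose s := b / (2 * xi); pose e := d - b ^+ 2 / (4 * xi).
  (* The last two entries centre [f] at [C] and [g] at [D]. The first one matches the Scherk
     equation, whose logarithms add up to [ln |B| + A + c * (u + v)]. *)
  exists c, (fun x => x + row4 (c^-1 * (ln `|B| + A)) s (- C) (- D - e)).
  split => // [|u v w Iu Jv Kw]; first exact: translation_isotropic_motion.
  have -> : translation_type2 f g h (row3 u v w) +
      row4 (c^-1 * (ln `|B| + A)) s (- C) (- D - e) =
      row4 (u + v + c^-1 * (ln `|B| + A)) (w + s) (f u - C)
        (g v - D + 3 * H0 / 2 * (w + s) ^+ 2).
    apply/rowP => i; rewrite !mxE /= hE // -xiE.
    by case: i => -[|[|[|[|]]]] // ? /=; rewrite /s /e; field.
  have [cosf lnf] := fE u Iu.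
  apply: scherk2_times_parabolicP => //.
    by rewrite gE // mulf_neq0 // gt_eqF // expR_gt0.
  rewrite lnf gE // normrM [`|expR _|]gtr0_norm ?expR_gt0 //.
  rewrite lnM ?posrE ?normr_gt0 ?expR_gt0 // expRK.
  by field.
have xiN : xi != 3 * H0 / 2.
  by apply: contraNneq k0 => ->; apply/eqP; field.
have hS : quadratic_profile K xi h.
  (* Now [xi] may vanish, and then the linear term of [h] survives. *)
  have [xi0|xi0] := eqVneq xi 0; last first.
    by left; exact: eq_up_to_shift_quadratic hE.
  right; split => //; exists b; apply: (@eq_up_to_shift_affine _ _ _ _ d).
  by move=> w Kw; rewrite hE // xi0 mul0r add0r.
have [g20|P0] := separated_equation_neq0 oI I0 oJ dQ dg1 Q0 PQ k0.
  have [g1E gE] := g_affine g20.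
  have PE u : I u -> P u * g1 v0 = 3 * H0 - 2 * xi.
    by move=> Iu; rewrite -(PQ u v0 Iu Jv0) g20 // mulr0 addr0.
  have mu0 : g1 v0 != 0.
    by apply: contraNneq k0 => g1v0; rewrite -(PE u0 Iu0) g1v0 mulr0.
  (* With [g2 = 0] the equation is [P * g1 v0 = k], so [F * F'] is the nonzero constant
     [- k / g1 v0], where [k] is [3 * H0 - 2 * xi]. *)
  have [||lambda lambda0 fE] :=
    @sqrt_profile _ _ _ _ _ (- (3 * H0 - 2 * xi) / g1 v0) iI I0 _ F0 dfF dF.
  - by rewrite mulf_neq0 ?oppr_eq0 ?invr_eq0.
  - by move=> u Iu; apply: FP; rewrite -(PE u Iu) mulNr opprK mulfK.
  exists lambda, (g1 v0), xi; right; right; left.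
  by split => //; rewrite mulf_neq0.
(* With [P = 0] the equation at [u0] gives [g2] the constant value [2 * mu]. *)
pose mu := (3 * H0 - 2 * xi) / Q u0 / 2.
have mu0 : mu != 0 by rewrite !mulf_neq0 ?invr_eq0 ?Q0 ?pnatr_eq0.
have [|b' [d' gE]] := @derive2_cst_quadratic _ _ g _ mu iJ J0 dg.
  move=> v Jv; have -> : 2 * mu = g2 v; last exact: dg1.
  rewrite /mu -(PQ u0 v Iu0 Jv) P0 // mul0r add0r.
  by have := Q0 u0 Iu0 => Qu0; field.
exists (f1 u0), mu, xi; do 3!right; left; split => //.
- by rewrite mulf_neq0 ?f10.
- by apply: f_affine => u Iu; apply: FP; rewrite P0 // oppr0.
- exact: eq_up_to_shift_quadratic gE.
Qed.
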